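(* Let $a,b,c>0$ with $a>b$, and let $M_0$ be the ellipsoid $\frac{x^2}{a}+\frac{y^2}{b}+\frac{z^2}{c}=1$ in $\mathbb{R}^3$ with the metric induced from the Minkowski metric $dx^2+dy^2-dz^2$. For a tangent vector $(u,v,w)$ to $M_0$ at the point $(x,y,z)\in M_0$ put $$J=\left(\frac{x^2}{a^2}+\frac{y^2}{b^2}-\frac{z^2}{c^2}\right)\left(\frac{u^2}{a}+\frac{v^2}{b}+\frac{w^2}{c}\right).$$ Then $J$ is an integral of the geodesic flow on $M_0$: for every parameterized geodesic $\gamma(t)=(x(t),y(t),z(t))$ of the induced metric, the value of $J$ at $(\gamma(t),\dot\gamma(t))$ does not depend on $t$.
   Context: Write $\langle\cdot,\cdot\rangle$ for the Minkowski metric $dx^2+dy^2-dz^2$. The induced metric on $M_0$ is degenerate exactly along the two curves $z=\pm c\sqrt{\frac{x^2}{a^2}+\frac{y^2}{b^2}}$ on $M_0$ (the tropics). Parameterized geodesics are considered off the tropics; they are the curves $\gamma(t)$ on $M_0$ that are extrema of $\int\langle\dot\gamma,\dot\gamma\rangle\,dt$, i.e. that satisfy $\ddot\gamma(t)=\lambda(t)N(\gamma(t))$ for some scalar function $\lambda(t)$, where $N(x,y,z)=\left(\frac{x}{a},\frac{y}{b},-\frac{z}{c}\right)$ is a Minkowski normal to $M_0$. *)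

(* Defs.v *)
From Stdlib Require Import Reals Lra.
From Coquelicot Require Import Coquelicot.
Open Scope R_scope.

(* A normed module (hence carrying vector-valued [is_derive]) through
   Coquelicot's product instances; [(x, y, z)] is [((x, y), z)]. *)
Definition R3 : Type := (R * R * R)%type.

Definition mink (p q : R3) : R :=
  let '(x1, y1, z1) := p in
  let '(x2, y2, z2) := q in
  x1 * x2 + y1 * y2 - z1 * z2.

(* The semi-axes are the square roots of a, b, c. *)
Definition M0 (a b c : R) (p : R3) : Prop :=
  let '(x, y, z) := p in x ^ 2 / a + y ^ 2 / b + z ^ 2 / c = 1.

Definition tangent (a b c : R) (p v : R3) : Prop :=
  let '(x, y, z) := p in
  let '(u, v, w) := v in x * u / a + y * v / b + z * w / c = 0.

Definition tropic (a b c : R) (p : R3) : Prop :=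
  let '(x, y, z) := p in
  z = c * sqrt (x ^ 2 / a ^ 2 + y ^ 2 / b ^ 2) \/
  z = - (c * sqrt (x ^ 2 / a ^ 2 + y ^ 2 / b ^ 2)).

Definition normal (a b c : R) (p : R3) : R3 :=
  let '(x, y, z) := p in (x / a, y / b, - (z / c)).

Lemma normal_orthogonal (a b c : R) (p v : R3) :
  tangent a b c p v <-> mink (normal a b c p) v = 0.
Proof.
  destruct p as [[x y] z], v as [[u v] w]; unfold tangent, mink, normal.
  unfold Rdiv; split; intros H; rewrite <- H; ring.
Qed.

(* Meaningful where [gamma] is differentiable, as [geodesic] demands. *)
Definition velocity (gamma : R -> R3) (t : R) : R3 :=
  (Derive (fun s => fst (fst (gamma s))) t,
   Derive (fun s => snd (fst (gamma s))) t,
   Derive (fun s => snd (gamma s)) t).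

Definition in_open_interval (alpha beta : Rbar) (t : R) : Prop :=
  Rbar_lt alpha t /\ Rbar_lt t beta.

(* Parameterized geodesic of M0 off the tropics, on the (possibly unbounded)
   open interval (alpha, beta): the acceleration is lambda(t) N(gamma(t)). *)
Definition geodesic (a b c : R) (alpha beta : Rbar) (gamma : R -> R3) : Prop :=
  exists lambda : R -> R,
    forall t : R, in_open_interval alpha beta t ->
      M0 a b c (gamma t) /\
      ~ tropic a b c (gamma t) /\
      is_derive gamma t (velocity gamma t) /\
      is_derive (velocity gamma) t (scal (lambda t) (normal a b c (gamma t))).

Definition J (a b c : R) (p v : R3) : R :=
  let '(x, y, z) := p in
  let '(u, v, w) := v in
  (x ^ 2 / a ^ 2 + y ^ 2 / b ^ 2 - z ^ 2 / c ^ 2) *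
  (u ^ 2 / a + v ^ 2 / b + w ^ 2 / c).

(* Main.v *)
Require Import Defs.
From Stdlib Require Import Reals Lra.
From Coquelicot Require Import Coquelicot.
Open Scope R_scope.

(** The normal map [S := normal a b c] is linear and self-adjoint for the
    Minkowski form [<p, q> := mink p q]; in terms of it the ellipsoid is
    [<S x, x> = 1] and [J = <S x, S x> <S v, v>]. No more is used. Along a
    geodesic [x' = v], [v' = lambda S x], differentiating [<S x, x> = 1] twice
    gives [<S x, v> = 0] and [<S v, v> + lambda <S x, S x> = 0]. Hence
    [J' = 2 <S v, S x> (<S v, v> + lambda <S x, S x>) = 0]. *)

Lemma minus_plus_plus_r {G : AbelianGroup} (x y z : G) :
  minus (plus x z) (plus y z) = minus x y.
Proof.
  unfold minus; rewrite opp_plus, (plus_comm (opp y)), <- plus_assoc.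
  now rewrite (plus_assoc z), plus_opp_r, plus_zero_l.
Qed.

Record is_bilinear {K : AbsRing} {U V W : NormedModule K} (B : U -> V -> W) :
  Prop := {
  bilinear_l : forall y : V, is_linear (fun x : U => B x y);
  bilinear_r : forall x : U, is_linear (B x);
  bilinear_norm : exists M : R,
    0 < M /\ forall (x : U) (y : V), norm (B x y) <= M * norm x * norm y
}.

Arguments bilinear_l {K U V W B}.
Arguments bilinear_r {K U V W B}.
Arguments bilinear_norm {K U V W B}.

Section BilinearDerivative.

Context {K : AbsRing} {U V W : NormedModule K} {B : U -> V -> W}.
Hypothesis B_bilinear : is_bilinear B.

Lemma bilinear_increment_remainder (x0 x : U) (y0 y : V) :
  minus (minus (B x y) (B x0 y0)) (plus (B (minus x x0) y0) (B x0 (minus y y0)))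
  = B (minus x x0) (minus y y0).
Proof.
  assert (Hincr : minus (B x y) (B x0 y0) =
    plus (B (minus x x0) y) (B x0 (minus y y0))).
  { rewrite (linear_minus _ x x0 (bilinear_l B_bilinear y)).
    rewrite (linear_minus _ y y0 (bilinear_r B_bilinear x0)).
    exact (minus_trans (B x0 y) (B x y) (B x0 y0)). }
  rewrite Hincr, (linear_minus _ y y0 (bilinear_r B_bilinear (minus x x0))).
  exact (minus_plus_plus_r (B (minus x x0) y) _ (B x0 (minus y y0))).
Qed.

Lemma is_linear_bilinear_diff (x0 : U) (y0 : V) :
  is_linear (fun h : U * V => plus (B (fst h) y0) (B x0 (snd h))).
Proof.
  apply (is_linear_comp (fun h : U * V => (B (fst h) y0, B x0 (snd h)))
           (fun w : W * W => plus (fst w) (snd w))); [ | apply is_linear_plus].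
  apply is_linear_prod.
  - exact (is_linear_comp _ _ is_linear_fst (bilinear_l B_bilinear y0)).
  - exact (is_linear_comp _ _ is_linear_snd (bilinear_r B_bilinear x0)).
Qed.

Lemma filterdiff_bilinear (x0 : U) (y0 : V) :
  filterdiff (fun p : U * V => B (fst p) (snd p)) (locally (x0, y0))
    (fun h => plus (B (fst h) y0) (B x0 (snd h))).
Proof.
  split; [apply is_linear_bilinear_diff | ].
  intros p Hp.
  rewrite <- (is_filter_lim_locally_unique (V := prod_NormedModule K U V) _ _ Hp).
  intros eps.
  destruct (bilinear_norm B_bilinear) as [M [HM HB]].
  apply (locally_le_locally_norm (V := prod_NormedModule K U V)).
  exists (mkposreal _ (Rdiv_lt_0_compat _ _ (cond_pos eps) HM)).
  intros [x y] Hball; unfold ball_norm in Hball; simpl in Hball |- *.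
  set (h := minus (x, y) (x0, y0)) in *.
  rewrite bilinear_increment_remainder.
  apply Rle_trans with (M * norm h * norm h).
  - apply Rle_trans with (1 := HB _ _).
    apply Rmult_le_compat.
    + apply Rmult_le_pos; [lra | apply norm_ge_0].
    + apply norm_ge_0.
    + apply Rmult_le_compat_l; [lra | exact (norm_le_prod_norm_1 h)].
    + exact (norm_le_prod_norm_2 h).
  - apply Rmult_le_compat_r; [apply norm_ge_0 | ].
    rewrite Rmult_comm; apply Rlt_le, Rlt_div_r; assumption.
Qed.

Lemma is_derive_bilinear (f : K -> U) (g : K -> V) (t : K) (f' : U) (g' : V) :
  is_derive f t f' -> is_derive g t g' ->
  is_derive (fun s => B (f s) (g s)) t (plus (B f' (g t)) (B (f t) g')).
Proof.
  intros Hf Hg.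
  apply (filterdiff_ext_lin _ _ _
    (filterdiff_comp'_2 f g B t _ _ (fun h k => plus (B h (g t)) (B (f t) k))
       Hf Hg (filterdiff_bilinear (f t) (g t)))).
  intros k; simpl.
  rewrite (linear_scal _ (bilinear_l B_bilinear _)).
  rewrite (linear_scal _ (bilinear_r B_bilinear _)).
  exact (eq_sym (scal_distr_l k (B f' (g t)) (B (f t) g'))).
Qed.

End BilinearDerivative.

Lemma is_derive_linear {K : AbsRing} {U V : NormedModule K} {L : U -> V}
  (f : K -> U) (t : K) (f' : U) :
  is_linear L -> is_derive f t f' -> is_derive (fun s => L (f s)) t (L f').
Proof.
  intros HL Hf.
  apply (filterdiff_ext_lin _ _ _
    (filterdiff_comp' f L t _ _ Hf (filterdiff_linear L HL))).
  intros k; exact (linear_scal L HL k f').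
Qed.

Lemma is_derive_locally_const (f : R -> R) (t k l : R) :
  locally t (fun s => f s = k) -> is_derive f t l -> l = 0.
Proof.
  intros Hk Hf.
  rewrite <- (is_derive_unique _ _ _ Hf), (Derive_ext_loc _ _ _ Hk).
  apply Derive_const.
Qed.

Definition joachimsthal {V : Type} (B : V -> V -> R) (S : V -> V) (p w : V) : R :=
  B (S p) (S p) * B (S w) w.

Section QuadricGeodesic.

Context {V : NormedModule R_AbsRing} {B : V -> V -> R} {S : V -> V}.
Hypothesis B_bilinear : is_bilinear B.
Hypothesis B_sym : forall p q, B p q = B q p.
Hypothesis S_linear : is_linear S.
Hypothesis S_selfadjoint : forall p q, B (S p) q = B p (S q).

Context {D : R -> Prop} {x v : R -> V} {lambda : R -> R} {k : R}.
Hypothesis D_open : open D.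
Hypothesis x_on_quadric : forall t, D t -> B (S (x t)) (x t) = k.
Hypothesis x_derive : forall t, D t -> is_derive x t (v t).
Hypothesis v_derive : forall t, D t -> is_derive v t (scal (lambda t) (S (x t))).

Lemma quadric_velocity_tangent (t : R) : D t -> B (S (x t)) (v t) = 0.
Proof.
  intros Ht.
  assert (HD := is_derive_bilinear B_bilinear _ _ t _ _
    (is_derive_linear _ _ _ S_linear (x_derive t Ht)) (x_derive t Ht)).
  apply (is_derive_locally_const _ t k) in HD.
  - rewrite S_selfadjoint, B_sym in HD.
    change (B (S (x t)) (v t) + B (S (x t)) (v t) = 0) in HD; lra.
  - exact (filter_imp _ _ x_on_quadric (D_open t Ht)).
Qed.

Lemma quadric_geodesic_multiplier (t : R) :
  D t -> B (S (v t)) (v t) + lambda t * B (S (x t)) (S (x t)) = 0.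
Proof.
  intros Ht.
  assert (HD := is_derive_bilinear B_bilinear _ _ t _ _
    (is_derive_linear _ _ _ S_linear (x_derive t Ht)) (v_derive t Ht)).
  apply (is_derive_locally_const _ t 0) in HD.
  - now rewrite (linear_scal _ (bilinear_r B_bilinear _)) in HD.
  - exact (filter_imp _ _ quadric_velocity_tangent (D_open t Ht)).
Qed.

Lemma is_derive_joachimsthal (t : R) :
  D t -> is_derive (fun s => joachimsthal B S (x s) (v s)) t 0.
Proof.
  intros Ht.
  assert (DSx := is_derive_linear _ _ _ S_linear (x_derive t Ht)).
  assert (DSv := is_derive_linear _ _ _ S_linear (v_derive t Ht)).
  assert (HD := is_derive_mult _ _ t _ _
    (is_derive_bilinear B_bilinear _ _ t _ _ DSx DSx)
    (is_derive_bilinear B_bilinear _ _ t _ _ DSv (v_derive t Ht)) Rmult_comm).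
  evar_last; [exact HD | ].
  rewrite (linear_scal S S_linear).
  rewrite (linear_scal _ (bilinear_l B_bilinear _)).
  rewrite (linear_scal _ (bilinear_r B_bilinear _)).
  rewrite (S_selfadjoint (S (x t)) (v t)), (B_sym (S (x t)) (S (v t))).
  set (P := B (S (v t)) (S (x t))).
  rewrite <- (Rmult_0_r (2 * P)), <- (quadric_geodesic_multiplier t Ht).
  unfold plus, mult, scal; simpl; unfold mult; simpl; ring.
Qed.

End QuadricGeodesic.

Lemma open_in_open_interval (alpha beta : Rbar) :
  open (in_open_interval alpha beta).
Proof.
  exact (open_and _ _ (open_Rbar_gt alpha) (open_Rbar_lt beta)).
Qed.

Lemma in_open_interval_between (alpha beta : Rbar) (s t r : R) :
  in_open_interval alpha beta s -> in_open_interval alpha beta t ->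
  s <= r <= t -> in_open_interval alpha beta r.
Proof.
  intros [Hs _] [_ Ht] [Hsr Hrt]; split.
  - now apply Rbar_lt_le_trans with (Finite s).
  - now apply Rbar_le_lt_trans with (Finite t).
Qed.

Lemma is_derive_0_const_in_open_interval {V : NormedModule R_AbsRing}
  (alpha beta : Rbar) (f : R -> V) :
  (forall t, in_open_interval alpha beta t -> is_derive f t zero) ->
  forall s t, in_open_interval alpha beta s -> in_open_interval alpha beta t ->
  f s = f t.
Proof.
  intros Hf.
  assert (Hlt : forall s t, in_open_interval alpha beta s ->
    in_open_interval alpha beta t -> s < t -> f s = f t).
  { intros s t Hs Ht; apply eq_is_derive; intros r Hr.
    exact (Hf r (in_open_interval_between _ _ _ _ _ Hs Ht Hr)). }
  intros s t Hs Ht.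
  destruct (Rtotal_order s t) as [Hst | [-> | Hst]].
  - exact (Hlt s t Hs Ht Hst).
  - reflexivity.
  - symmetry; exact (Hlt t s Ht Hs Hst).
Qed.

Lemma mink_sym (p q : R3) : mink p q = mink q p.
Proof. destruct p as [[x y] z], q as [[u v] w]; simpl; ring. Qed.

Lemma norm_mink_le (p q : R3) : norm (mink p q) <= 3 * norm p * norm q.
Proof.
  assert (Hcoord : forall r : R3, Rabs (fst (fst r)) <= norm r /\
    Rabs (snd (fst r)) <= norm r /\ Rabs (snd r) <= norm r).
  { intros r; split; [ | split].
    - exact (Rle_trans _ _ _
        (norm_le_prod_norm_1 (fst r)) (norm_le_prod_norm_1 r)).
    - exact (Rle_trans _ _ _
        (norm_le_prod_norm_2 (fst r)) (norm_le_prod_norm_1 r)).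
    - exact (norm_le_prod_norm_2 r). }
  assert (Hprod : forall s t : R, Rabs s <= norm p -> Rabs t <= norm q ->
    Rabs (s * t) <= norm p * norm q).
  { intros s t Hs Ht; rewrite Rabs_mult.
    apply Rmult_le_compat; auto using Rabs_pos. }
  destruct (Hcoord p) as (Hx & Hy & Hz), (Hcoord q) as (Hu & Hv & Hw).
  assert (Hxu := Hprod _ _ Hx Hu); assert (Hyv := Hprod _ _ Hy Hv).
  assert (Hzw := Hprod _ _ Hz Hw).
  destruct p as [[x y] z], q as [[u v] w]; simpl in Hxu, Hyv, Hzw.
  apply Rabs_le_between in Hxu, Hyv, Hzw.
  apply Rabs_le_between; simpl; lra.
Qed.

Lemma is_linear_mink_l (q : R3) : is_linear (fun p : R3 => mink p q).
Proof.
  split.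
  - intros [[x y] z] [[x' y'] z']; destruct q as [[u v] w].
    unfold plus; simpl; unfold plus; simpl; ring.
  - intros k [[x y] z]; destruct q as [[u v] w].
    unfold scal; simpl; unfold scal; simpl; unfold mult; simpl; ring.
  - exists (3 * norm q + 1); split.
    + generalize (norm_ge_0 q); lra.
    + intros p; generalize (norm_mink_le p q) (norm_ge_0 p); lra.
Qed.

Lemma is_bilinear_mink : is_bilinear mink.
Proof.
  split.
  - exact is_linear_mink_l.
  - intros p; apply (is_linear_ext (fun q => mink q p)).
    + intros q; apply mink_sym.
    + apply is_linear_mink_l.
  - exists 3; split; [lra | exact norm_mink_le].
Qed.

Section Ellipsoid.

Variables a b c : R.

Lemma is_linear_normal : is_linear (normal a b c).
Proof.
  assert (Hscal : forall k : R, is_linear (fun r : R => scal k r)).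
  { intros k; exact (is_linear_scal_r k Rmult_comm). }
  assert (Hx : is_linear (fun p : R3 => scal (/ a) (fst (fst p)))).
  { exact (is_linear_comp _ _
      (is_linear_comp _ _ is_linear_fst is_linear_fst) (Hscal _)). }
  assert (Hy : is_linear (fun p : R3 => scal (/ b) (snd (fst p)))).
  { exact (is_linear_comp _ _
      (is_linear_comp _ _ is_linear_fst is_linear_snd) (Hscal _)). }
  assert (Hz : is_linear (fun p : R3 => scal (- / c) (snd p))).
  { exact (is_linear_comp _ _ is_linear_snd (Hscal _)). }
  refine (is_linear_ext _ _ _ (is_linear_prod _ _ (is_linear_prod _ _ Hx Hy) Hz)).
  intros [[x y] z]; unfold scal; simpl; unfold mult; simpl.
  unfold Rdiv; f_equal; [f_equal | ]; ring.
Qed.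

Lemma mink_normal_selfadjoint (p q : R3) :
  mink (normal a b c p) q = mink p (normal a b c q).
Proof.
  destruct p as [[x y] z], q as [[u v] w]; simpl; unfold Rdiv; ring.
Qed.

Lemma M0_mink_normal (p : R3) : M0 a b c p <-> mink (normal a b c p) p = 1.
Proof.
  destruct p as [[x y] z]; unfold M0.
  replace (mink _ _) with (x ^ 2 / a + y ^ 2 / b + z ^ 2 / c)
    by (simpl; unfold Rdiv; ring).
  reflexivity.
Qed.

Lemma J_joachimsthal (p w : R3) :
  J a b c p w = joachimsthal mink (normal a b c) p w.
Proof.
  destruct p as [[x y] z], w as [[u v] w].
  unfold joachimsthal; simpl; unfold Rdiv; rewrite !Rmult_1_r, !Rinv_mult; ring.
Qed.

End Ellipsoid.

Theorem proposition2p1 (a b c : R) (Ha : 0 < a) (Hb : 0 < b) (Hc : 0 < c)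
  (Hab : b < a) (alpha beta : Rbar) (gamma : R -> R3)
  (Hgamma : geodesic a b c alpha beta gamma) :
  forall s t : R,
    in_open_interval alpha beta s -> in_open_interval alpha beta t ->
    J a b c (gamma s) (velocity gamma s) = J a b c (gamma t) (velocity gamma t).
Proof.
  destruct Hgamma as [lambda Hgeo].
  apply (is_derive_0_const_in_open_interval alpha beta
    (fun s => J a b c (gamma s) (velocity gamma s))).
  intros t Ht.
  apply (is_derive_ext (fun s =>
    joachimsthal mink (normal a b c) (gamma s) (velocity gamma s))).
  { intros s; symmetry; apply J_joachimsthal. }
  apply (is_derive_joachimsthal (lambda := lambda) (k := 1)
    is_bilinear_mink mink_sym (is_linear_normal a b c)
    (mink_normal_selfadjoint a b c) (open_in_open_interval alpha beta));
    [intros s Hs .. | exact Ht];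
    destruct (Hgeo s Hs) as (Hon & _ & Hvel & Hacc).
  - now apply M0_mink_normal.
  - exact Hvel.
  - exact Hacc.
Qed.
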